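(* Let $D_1,D_2\ge1$, $D=D_1D_2$, let $\varrho$ be a density operator on $\mathbb{C}^{D_1}\otimes\mathbb{C}^{D_2}$, and let $\varrho_1=\mathrm{Tr}_2\,\varrho$ and $\varrho_2=\mathrm{Tr}_1\,\varrho$ be its reduced density operators. Then $$\max\{0,\ D_2\Sigma(\varrho_1)+D_1\Sigma(\varrho_2)-D\}\ \le\ \Sigma(\varrho)\ \le\ \min\{D_2\Sigma(\varrho_1),\ D_1\Sigma(\varrho_2)\}.$$
   Context: For a density operator $\omega$ on $\mathbb{C}^{d}$ the grand sum is $\Sigma(\omega)=\sum_{i,j=1}^{d}\omega_{ij}=d\,\langle f_1^{(d)}|\omega|f_1^{(d)}\rangle$, where matrix entries are taken in the standard basis and $|f_1^{(d)}\rangle=\frac1{\sqrt d}\sum_{j=1}^d|j\rangle$. For the bipartite space $\mathbb{C}^{D_1}\otimes\mathbb{C}^{D_2}$ the product standard basis is used, so that $|f_1^{(D)}\rangle=|f_1^{(D_1)}\rangle\otimes|f_1^{(D_2)}\rangle$. *)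

(* Defs.v *)
From mathcomp Require Import all_boot all_order all_algebra.
From mathcomp Require Import reals complex mxtens.
Set Implicit Arguments.
Unset Strict Implicit.
Unset Printing Implicit Defensive.
Import Order.TTheory GRing.Theory Num.Theory.
Local Open Scope ring_scope.
Local Open Scope complex_scope.
Local Open Scope sesquilinear_scope.

(* The order on R[i] is partial: 0 <= z means that z is a nonnegative real. *)

Definition psdmx (R : realType) d (A : 'M[R[i]]_d) : Prop :=
  A \is hermsymmx /\
  forall v : 'cV[R[i]]_d, 0 <= (v ^t* *m A *m v) 0 0.

Definition density_operator (R : realType) d (A : 'M[R[i]]_d) : Prop :=
  psdmx A /\ \tr A = 1.

Definition grand_sum (R : realType) d (A : 'M[R[i]]_d) : R[i] :=
  \sum_(i < d) \sum_(j < d) A i j.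

(* C^D1 (x) C^D2 is C^(D1 * D2) through the product basis of mxtens:
   |i> (x) |j> is the basis vector of index mxtens_index (i, j), the same
   convention as the Kronecker product *t.  ptrace1 = Tr_1 sums over the first
   factor and ptrace2 = Tr_2 over the second. *)

Definition ptrace1 (R : realType) D1 D2 (A : 'M[R[i]]_(D1 * D2)) : 'M[R[i]]_D2 :=
  \matrix_(k < D2, l < D2)
    \sum_(i < D1) A (mxtens_index (i, k)) (mxtens_index (i, l)).

Definition ptrace2 (R : realType) D1 D2 (A : 'M[R[i]]_(D1 * D2)) : 'M[R[i]]_D1 :=
  \matrix_(i < D1, j < D1)
    \sum_(k < D2) A (mxtens_index (i, k)) (mxtens_index (j, k)).

(* The grand sum of a density operator is real, so that Num.max and Num.min
   of grand sums, taken in R[i], compare real numbers. *)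
Lemma grand_sum_real (R : realType) d (A : 'M[R[i]]_d) :
  A \is hermsymmx -> grand_sum A \is Num.real.
Proof.
move=> /eqP hA; apply/CrealP; rewrite /grand_sum rmorph_sum exchange_big /=.
rewrite -(rmorph_sum Num.conj) /= rmorph_sum /=; apply: eq_bigr => i _.
rewrite rmorph_sum; apply: eq_bigr => j _.
by rewrite {2}hA expr0 scale1r !mxE.
Qed.

(* Main.v *)
(** With [U] the all-ones matrix, [Sigma rho = tr (rho (U (x) U))] and
    [D2 Sigma rho1 = tr (rho (U (x) D2))].  The matrices [U] and [d - U] are [d]
    times complementary orthogonal projectors, so the four tensor products built
    from them are positive multiples of projectors and have nonnegative trace
    against [rho]: these are the four inequalities. *)

Require Import Defs.
From mathcomp Require Import all_boot all_order all_algebra.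
From mathcomp Require Import reals complex mxtens ring.
Import Order.TTheory GRing.Theory Num.Theory.
Local Open Scope ring_scope.
Local Open Scope complex_scope.
Local Open Scope sesquilinear_scope.

Lemma tensmxBl (R : pzRingType) m n p q (A A' : 'M[R]_(m, n)) (B : 'M[R]_(p, q)) :
  (A - A') *t B = A *t B - A' *t B.
Proof. by apply/matrixP=> i j; rewrite !mxE mulrBl. Qed.

Lemma tensmxBr (R : pzRingType) m n p q (A : 'M[R]_(m, n)) (B B' : 'M[R]_(p, q)) :
  A *t (B - B') = A *t B - A *t B'.
Proof. by apply/matrixP=> i j; rewrite !mxE mulrBr. Qed.

Lemma sum_mxtens_index (V : nmodType) m n (F : 'I_(m * n) -> V) :
  \sum_k F k = \sum_i \sum_j F (mxtens_index (i, j)).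
Proof.
rewrite pair_bigA /= (reindex (@mxtens_index m n)) /=; last first.
  exists (@mxtens_unindex m n) => k _; first exact: mxtens_indexK.
  exact: mxtens_unindexK.
by apply: eq_bigr => -[].
Qed.

(** For real [c != 0] this says that [X / c] is an orthogonal projector; keeping the factor [c]
    avoids dividing by dimensions. *)
Definition scaled_projmx {C : numClosedFieldType} {n} (c : C) (X : 'M[C]_n) : Prop :=
  X ^t* = X /\ X *m X = c *: X.

Lemma scaled_projmx_tens {C : numClosedFieldType} {m n} {a b : C}
    {A : 'M[C]_m} {B : 'M[C]_n} :
  scaled_projmx a A -> scaled_projmx b B -> scaled_projmx (a * b) (A *t B).
Proof.
move=> [hA pA] [hB pB]; split; first by rewrite trmx_tens map_mxT hA hB.
by rewrite tensmx_mul pA pB; apply/matrixP=> i j; rewrite !mxE mulrACA.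
Qed.

Lemma scaled_projmx_ones (C : numClosedFieldType) n :
  scaled_projmx n%:R (const_mx 1 : 'M[C]_n).
Proof.
split; first by apply/matrixP=> i j; rewrite !mxE rmorph1.
apply/matrixP=> i j; rewrite !mxE (eq_bigr (fun=> 1)) => [|k _].
  by rewrite sumr_const card_ord mulr1.
by rewrite !mxE mulr1.
Qed.

(** [X (m - X) = m X - X X] vanishes, so [(m - X) (m - X) = m (m - X)]. *)
Lemma scaled_projmx_compl {C : numClosedFieldType} {n m} {X : 'M[C]_n} :
  scaled_projmx m%:R X -> scaled_projmx m%:R (m%:R%:M - X).
Proof.
move=> [hX pX]; split.
  by rewrite linearB map_mxB /= hX tr_scalar_mx map_scalar_mx /= rmorph_nat.
by rewrite mulmxBl !mulmxBr pX !mul_mx_scalar !mul_scalar_mx subrr subr0 scalerBr.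
Qed.

(** By cyclicity [c tr (A X) = tr (A X X) = tr (X^* A X)], whose diagonal entries are values of the
    quadratic form of [A] at the columns of [X]. *)
Lemma psdmx_tr_mul_scaled_proj {R : realType} {n} {A X : 'M[R[i]]_n} {c} :
  0 < c -> psdmx A -> scaled_projmx c X -> 0 <= \tr (A *m X).
Proof.
move=> c0 [_ pA] [hX pX].
rewrite -(pmulr_rge0 _ c0) -mxtraceZ scalemxAr -pX mulmxA mxtrace_mulC.
rewrite -{1}hX mulmxA; apply: sumr_ge0 => k _.
suff -> : (X ^t* *m A *m X) k k = ((col k X) ^t* *m A *m col k X) 0 0 by exact: pA.
rewrite !mxE; apply: eq_bigr => j _; rewrite !mxE; congr (_ * _).
by apply: eq_bigr => l _; rewrite !mxE.
Qed.

Lemma grand_sum_tr (R : realType) d (A : 'M[R[i]]_d) :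
  grand_sum A = \tr (A *m const_mx 1).
Proof.
by apply: eq_bigr => i _; rewrite mxE; apply: eq_bigr => j _; rewrite mxE mulr1.
Qed.

Lemma tens_const_mx1 (R : pzRingType) m n p q :
  (const_mx 1 : 'M[R]_(m, n)) *t (const_mx 1 : 'M[R]_(p, q)) = const_mx 1.
Proof. by apply/matrixP=> i j; rewrite !mxE mulr1. Qed.

(** Duality: [Tr_2] is adjoint to tensoring with the identity. *)
Lemma tr_mul_tens_scalarr (R : realType) D1 D2 (A : 'M[R[i]]_(D1 * D2))
    (X : 'M[R[i]]_D1) b :
  \tr (A *m (X *t b%:M)) = b * \tr (ptrace2 A *m X).
Proof.
rewrite /mxtrace sum_mxtens_index mulr_sumr; apply: eq_bigr => i _.
rewrite mxE mulr_sumr.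
under eq_bigr do rewrite mxE sum_mxtens_index.
rewrite exchange_big; apply: eq_bigr => j _ /=.
rewrite mxE mulr_suml mulr_sumr; apply: eq_bigr => k _.
(* [b%:M] is diagonal, so only equal second indices survive. *)
rewrite (bigD1 k) //= big1 ?addr0 => [|l lk]; rewrite tensmxE mxE.
  by rewrite eqxx mulr1n [RHS]mulrC mulrA.
by rewrite (negPf lk) !mulr0.
Qed.

Lemma tr_mul_tens_scalarl (R : realType) D1 D2 (A : 'M[R[i]]_(D1 * D2))
    (X : 'M[R[i]]_D2) a :
  \tr (A *m (a%:M *t X)) = a * \tr (ptrace1 A *m X).
Proof.
(* The second factor's index goes outermost, as [ptrace1] sums over the first. *)
rewrite /mxtrace sum_mxtens_index exchange_big mulr_sumr.
apply: eq_bigr => k _; rewrite mxE mulr_sumr /=.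
under eq_bigr do rewrite mxE sum_mxtens_index exchange_big.
rewrite exchange_big; apply: eq_bigr => l _ /=.
rewrite mxE mulr_suml mulr_sumr; apply: eq_bigr => i _.
rewrite (bigD1 i) //= big1 ?addr0 => [|j ji]; rewrite tensmxE mxE.
  by rewrite eqxx mulr1n mulrCA.
by rewrite (negPf ji) mul0r mulr0.
Qed.

Lemma mxtrace_ptrace2 (R : realType) D1 D2 (A : 'M[R[i]]_(D1 * D2)) :
  \tr (ptrace2 A) = \tr A.
Proof. by rewrite /mxtrace sum_mxtens_index; apply: eq_bigr => i _; rewrite mxE. Qed.

Theorem mainTheorem5 (R : realType) (D1 D2 : nat)
    (hD1 : (1 <= D1)%N) (hD2 : (1 <= D2)%N)
    (rho : 'M[R[i]]_(D1 * D2)) (hrho : density_operator rho) :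
  Num.max 0 (D2%:R * grand_sum (ptrace2 rho) + D1%:R * grand_sum (ptrace1 rho)
             - (D1 * D2)%:R)
    <= grand_sum rho
  /\ grand_sum rho
    <= Num.min (D2%:R * grand_sum (ptrace2 rho)) (D1%:R * grand_sum (ptrace1 rho)).
Proof.
have [rho_psd tr_rho] := hrho.
pose U1 : 'M[R[i]]_D1 := const_mx 1; pose U2 : 'M[R[i]]_D2 := const_mx 1.
have pU1 : scaled_projmx D1%:R U1 := scaled_projmx_ones _ _.
have pU2 : scaled_projmx D2%:R U2 := scaled_projmx_ones _ _.
have D0 : 0 < D1%:R * D2%:R :> R[i] by rewrite mulr_gt0 ?ltr0n.
pose T A B := \tr (rho *m (A *t B)).
have TBl A A' B : T (A - A') B = T A B - T A' B.
  by rewrite /T tensmxBl mulmxBr raddfB.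
have TBr A B B' : T A (B - B') = T A B - T A B'.
  by rewrite /T tensmxBr mulmxBr raddfB.
have pos A B : scaled_projmx D1%:R A -> scaled_projmx D2%:R B -> 0 <= T A B.
  by move=> hA hB; apply: psdmx_tr_mul_scaled_proj D0 _ (scaled_projmx_tens hA hB).
have E12 : T U1 U2 = grand_sum rho by rewrite /T tens_const_mx1 -grand_sum_tr.
have E1 : T U1 D2%:R%:M = D2%:R * grand_sum (ptrace2 rho).
  by rewrite /T tr_mul_tens_scalarr -grand_sum_tr.
have E2 : T D1%:R%:M U2 = D1%:R * grand_sum (ptrace1 rho).
  by rewrite /T tr_mul_tens_scalarl -grand_sum_tr.
(* The normalization [tr rho = 1] produces the constant [D]. *)
have E0 : T D1%:R%:M D2%:R%:M = (D1 * D2)%:R.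
  rewrite /T tr_mul_tens_scalarr mul_mx_scalar mxtraceZ mxtrace_ptrace2 tr_rho.
  by rewrite mulr1 mulrC natrM.
have pK1 := scaled_projmx_compl pU1; have pK2 := scaled_projmx_compl pU2.
(* Unification would otherwise unfold the matrices, which is very slow. *)
clearbody T U1 U2.
have := pos _ _ pU1 pU2; rewrite E12 => ge0.
have := pos _ _ pU1 pK2; rewrite TBr E1 E12 subr_ge0 => le1.
have := pos _ _ pK1 pU2; rewrite TBl E2 E12 subr_ge0 => le2.
(* Inclusion-exclusion: this trace is [D - D1 Sigma(rho2) - D2 Sigma(rho1) + Sigma(rho)]. *)
have := pos _ _ pK1 pK2; rewrite TBl !TBr E0 E1 E2 E12 => le12.
(* The order on [R[i]] is partial, but [min] and [max] unfold to an [if] whose branches are each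
   bounded by an inequality above. *)
split; last by rewrite /Order.min; case: ifP.
rewrite /Order.max; case: ifP => // _.
rewrite -subr_ge0; move: le12; congr (0 <= _); ring.
Qed.
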